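(* Let $(\mathscr{E},\mathscr{C}_{\mathscr{E}})$ and $(\mathscr{F},\mathscr{C}_{\mathscr{F}})$ be continuous fields of Banach spaces over a topological space $X$. Let $S=(S_x)_{x\in X}$ be a section of closed operators ($S_x$ a closed operator from $\mathscr{E}_x$ to $\mathscr{F}_x$), let $(T_\alpha)_{\alpha\in A}$ be a net in $\mathsf{Cl}(\mathscr{E},\mathscr{F})$ and $T_\infty\in\mathsf{Cl}(\mathscr{E},\mathscr{F})$. (1) If $S_x$ is injective for all $x\in X$, then $S^{-1}=(S_x^{-1})_{x\in X}$ is a section of closed operators from $\mathscr{F}$ to $\mathscr{E}$, and $S$ is G-continuous if and only if $S^{-1}$ is G-continuous. (2) If all $T_\alpha$ and $T_\infty$ are injective, then $T_\alpha\xrightarrow{G}T_\infty$ if and only if $T_\alpha^{-1}\xrightarrow{G}T_\infty^{-1}$. (3) If $S_x:D(S_x)\to\mathscr{F}_x$ is bijective for all $x\in X$ and $S^{-1}$ is locally bounded (every $x_0\in X$ has a neighborhood $U$ with $\sup_{x\in U}\|S_x^{-1}\|<\infty$), then $S$ is G-continuous if and only if $S^{-1}\in\mathscr{C}^{\mathsf{s}}(\mathscr{F},\mathscr{E})$. (4) If all $T_\alpha$ and $T_\infty$ are bijective (from their domains onto the respective fibers of $\mathscr{F}$), then $T_\alpha^{-1}\xrightarrow{\mathsf{ms}}T_\infty^{-1}$ implies $T_\alpha\xrightarrow{G}T_\infty$. If, in addition, $\sup_{\alpha\ge\alpha_0}\|T_\alpha^{-1}\|<\infty$ for some $\alpha_0\in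 A$, then $$T_\alpha\xrightarrow{G}T_\infty\iff T_\alpha^{-1}\xrightarrow{\mathsf{ms}}T_\infty^{-1}.$$
   Context: A section of a family $\mathscr{E}=(\mathscr{E}_x)_{x\in X}$ of vector spaces is a map $f$ on $X$ with $f(x)\in\mathscr{E}_x$; $\Gamma(\mathscr{E})$ is the vector space of sections; $\mathscr{E}$ is also identified with the disjoint union $\bigsqcup_x\mathscr{E}_x$ with projection $\pi:\mathscr{E}\to X$. $(\mathscr{E},\mathscr{C})$ is a continuous field of Banach spaces over $X$ if every $\mathscr{E}_x$ is a Banach space and $\mathscr{C}\subset\Gamma(\mathscr{E})$ is a linear subspace such that: (a) $x\mapsto\|f(x)\|$ is continuous for all $f\in\mathscr{C}$; (b) every $g\in\Gamma(\mathscr{E})$ such that for all $x\in X,\varepsilon>0$ there are $f\in\mathscr{C}$ and a neighborhood $U$ of $x$ with $\|g(y)-f(y)\|\le\varepsilon$ for all $y\in U$ belongs to $\mathscr{C}$; (c) for all $x\in X,\zeta\in\mathscr{E}_x$ there is $f\in\mathscr{C}$ with $f(x)=\zeta$. The total space $\mathscr{E}$ carries the topology with base $U(V,f,\varepsilon)=\{\zeta\in\mathscr{E}:\pi(\zeta)\in V,\ \|\zeta-f(\pi(\zeta))\|<\varepsilon\}$, $V\subset X$ open, $f\in\mathscr{C}$, $\varepsilon>0$; limits of nets in $\mathscr{E}$ and $\mathscr{F}$ refer to this topology. $\mathsf{Cl}(\mathscr{E},\mathscr{F})$ is the set of all closed operators $T$ from $\mathscr{E}_x$ to $\mathscr{F}_x$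 for some $x=:\pi(T)\in X$, with domain $D(T)\subset\mathscr{E}_x$. A section $S$ of closed operators is G-continuous if for each $x\in X$, $\zeta\in D(S_x)$ there is $f\in\mathscr{C}_{\mathscr{E}}$ with $f(y)\in D(S_y)$ for all $y$, $(y\mapsto S_yf(y))\in\mathscr{C}_{\mathscr{F}}$ and $f(x)=\zeta$ (analogously with $\mathscr{E},\mathscr{F}$ interchanged). $T_\alpha\xrightarrow{G}T_\infty$ means: $\pi(T_\alpha)\to\pi(T_\infty)$ and for any $\zeta\in D(T_\infty)$ there exist $\zeta_\alpha\in D(T_\alpha)$ with $\lim\zeta_\alpha=\zeta$ and $\lim T_\alpha\zeta_\alpha=T_\infty\zeta$. For bounded operators, $\mathscr{L}(\mathscr{F},\mathscr{E})$ is the set of all $B\in\mathscr{L}(\mathscr{F}_x,\mathscr{E}_x)$ for some $x=:\pi(B)$; $\mathscr{C}^{\mathsf{s}}(\mathscr{F},\mathscr{E})$ is the set of sections $B$ with $B(x)\in\mathscr{L}(\mathscr{F}_x,\mathscr{E}_x)$ and $(x\mapsto B(x)f(x))\in\mathscr{C}_{\mathscr{E}}$ for all $f\in\mathscr{C}_{\mathscr{F}}$. $B_\alpha\xrightarrow{\mathsf{ms}}B_\infty$ (meta strong convergence) means: $\pi(B_\alpha)\to\pi(B_\infty)$ and for all $\zeta_\alpha\in\mathscr{F}_{\pi(B_\alpha)}$ $(\alpha\in A\cup\{\infty\})$, $\lim_\alpha\zeta_\alpha=\zeta_\infty$ in $\mathscr{F}$ implies $\lim_\alpha B_\alpha\zeta_\alpha=B_\infty\zeta_\infty$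 in $\mathscr{E}$. *)

(* Defs.v *)
From HB Require Import structures.
From mathcomp Require Import all_boot all_order all_algebra.
From mathcomp Require Import all_classical all_reals all_analysis.
From mathcomp Require Import complex.
Set Implicit Arguments.
Unset Strict Implicit.
Unset Printing Implicit Defensive.
Import Order.TTheory GRing.Theory Num.Theory.
Import numFieldNormedType.Exports.
Local Open Scope classical_set_scope.
Local Open Scope ring_scope.

(* Banach spaces are taken over the reals or over the complex numbers. *)
Variant scalar_kind := RealScalars | ComplexScalars.

Definition scalar_field (R : realType) (k : scalar_kind) : numFieldType :=
  match k with RealScalars => R | ComplexScalars => R[i] end.

(* In a normed module over K, `|v| is an element of K. In the complex case it
   has zero imaginary part, and no information is lost by taking Re. *)
Definition real_part (R : realType) (k : scalar_kind) : scalar_field R k -> R :=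
  match k return scalar_field R k -> R with
  | RealScalars => id
  | ComplexScalars => @complex.Re R
  end.

Definition rnorm (R : realType) (k : scalar_kind)
  (V : normedModType (scalar_field R k)) (v : V) : R := real_part `|v|.

Section RealNorm.
Context (R : realType) (k : scalar_kind).

Lemma real_part0 : real_part (0 : scalar_field R k) = 0.
Proof. by case: k. Qed.

Lemma real_partD (a b : scalar_field R k) :
  real_part (a + b) = real_part a + real_part b.
Proof. by case: k a b => //= -[? ?] []. Qed.

Lemma le_real_part (a b : scalar_field R k) : a <= b -> real_part a <= real_part b.
Proof. by case: k a b => //= a b; rewrite lecE => /andP[]. Qed.

Context (V : normedModType (scalar_field R k)).
Implicit Types u v w : V.

Lemma rnorm0 : rnorm (0 : V) = 0.
Proof. by rewrite /rnorm normr0 real_part0. Qed.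

Lemma rnorm_tri u v w : rnorm (u - w) <= rnorm (u - v) + rnorm (v - w).
Proof. by rewrite /rnorm -real_partD; exact: le_real_part (ler_distD _ _ _). Qed.

End RealNorm.

Record continuous_field (R : realType) (k : scalar_kind) (X : topologicalType) :=
  ContinuousField {
    fiber :> X -> completeNormedModType (scalar_field R k);
    sections : set (forall x, fiber x);
    sections_zero : sections (fun=> 0);
    sections_linear : forall (a : scalar_field R k) f g, sections f -> sections g ->
      sections (fun x => a *: f x + g x);
    sections_norm : forall f, sections f ->
      continuous (fun x => rnorm (f x));
    sections_local : forall g : forall x, fiber x,
      (forall (x : X) (e : R), 0 < e -> exists2 f, sections f &
         \forall y \near x, rnorm (g y - f y) <= e) ->
      sections g;
    sections_full : forall (x : X) (v : fiber x),
      exists2 f, sections f & f x = v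
  }.
Arguments sections {R k X} _ _.

Definition total_space (R : realType) (k : scalar_kind) (X : topologicalType)
  (E : continuous_field R k X) : Type := {x : X & E x}.

Definition point_of (R : realType) (k : scalar_kind) (X : topologicalType)
  (E : continuous_field R k X) (x : X) (v : E x) : total_space E :=
  existT (fun x => E x : Type) x v.

Section TotalSpace.
Context (R : realType) (k : scalar_kind) (X : topologicalType).
Variable E : continuous_field R k X.

Definition tube (V : set X) (f : forall x, E x) (e : R) : set (total_space E) :=
  [set p | V (projT1 p) /\ rnorm (projT2 p - f (projT1 p)) < e].

Definition tubes : set (set (total_space E)) :=
  [set U | exists (V : set X) (f : forall x, E x) (e : R),
     [/\ open V, sections E f, 0 < e & U = tube V f e]].

Lemma sections_sub f g : sections E f -> sections E g ->
  sections E (fun x => f x - g x).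
Proof.
move=> Cf Cg; rewrite (_ : (fun x => f x - g x) = fun x => -1 *: g x + f x).
  exact: sections_linear.
by apply: functional_extensionality_dep => x; rewrite scaleN1r addrC.
Qed.

Lemma tubes_cover : \bigcup_(U in tubes) U = setT.
Proof.
apply/seteqP; split=> // -[x v] _.
have [f Cf fx] := sections_full v.
exists (tube setT f 1); first by exists setT, f, 1; split=> //; exact: openT.
by split=> //=; rewrite fx subrr rnorm0.
Qed.

Lemma tubes_join (U1 U2 : set (total_space E)) p : tubes U1 -> tubes U2 ->
  U1 p -> U2 p -> exists U, [/\ tubes U, U p & U `<=` U1 `&` U2].
Proof.
case: p => x v [V1 [f1 [e1 [oV1 Cf1 e1p ->]]]] [V2 [f2 [e2 [oV2 Cf2 e2p ->]]]].
move=> [/= V1x vf1] [/= V2x vf2].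
have [h Ch hx] := sections_full v.
pose a := Num.min (e1 - rnorm (v - f1 x)) (e2 - rnorm (v - f2 x)).
have a0 : 0 < a by rewrite lt_min !subr_gt0 vf1 vf2.
have a20 : 0 < a / 2 by rewrite divr_gt0.
pose W f e := [set y | rnorm (h y - f y) < e - a / 2].
have oW f e : sections E f -> open (W f e).
  move=> Cf; have cf := sections_norm (sections_sub Ch Cf).
  have -> : W f e = (fun x => rnorm (h x - f x)) @^-1` [set r | r < e - a / 2].
    by [].
  by apply: open_comp; [move=> y _; exact: cf | exact: open_lt].
have aa : a / 2 < a by rewrite ltr_pdivrMr // ltr_pMr // ltr1n.
exists (tube (V1 `&` V2 `&` (W f1 e1 `&` W f2 e2)) h (a / 2)); split.
- exists (V1 `&` V2 `&` (W f1 e1 `&` W f2 e2)), h, (a / 2); split=> //.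
  by apply: openI; apply: openI => //; exact: oW.
- split=> /=; last by rewrite hx subrr rnorm0.
  split=> //; split; rewrite /W /= hx ltrBrDl -ltrBrDr (lt_le_trans aa)//.
    by rewrite ge_min lexx.
  by rewrite ge_min lexx orbT.
- move=> [y w] [/= [[V1y V2y] [W1 W2]] wh]; split; split=> //=.
    apply: (le_lt_trans (rnorm_tri _ (h y) _)).
    by rewrite -(subrKC (a / 2) e1) ltrD.
  apply: (le_lt_trans (rnorm_tri _ (h y) _)).
  by rewrite -(subrKC (a / 2) e2) ltrD.
Qed.

HB.instance Definition _ := Choice.copy (total_space E) {x : X & E x}.
HB.instance Definition _ :=
  isBaseTopological.Build (total_space E) tubes_cover tubes_join.

End TotalSpace.

(* An operator with domain: the values of op_fun outside op_dom are junk. *)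
Record operator (K : numFieldType) (V W : normedModType K) := Operator {
  op_dom : set V;
  op_fun :> V -> W
}.

Section Operators.
Context (R : realType) (k : scalar_kind).
Implicit Types V W : completeNormedModType (scalar_field R k).

Definition linear_operator V W (T : operator V W) : Prop :=
  [/\ op_dom T 0,
      forall a u v, op_dom T u -> op_dom T v -> op_dom T (a *: u + v) &
      forall a u v, op_dom T u -> op_dom T v -> T (a *: u + v) = a *: T u + T v].

Definition op_graph V W (T : operator V W) : set (V * W) :=
  [set p | op_dom T p.1 /\ p.2 = T p.1].

Definition closed_operator V W (T : operator V W) : Prop :=
  linear_operator T /\ closed (op_graph T).

Definition injective_operator V W (T : operator V W) : Prop :=
  set_inj (op_dom T) T.

Definition bijective_operator V W (T : operator V W) : Prop :=
  set_bij (op_dom T) [set: W] T.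

Definition inv_operator V W (T : operator V W) : operator W V :=
  Operator (T @` op_dom T) ('pinv_(fun=> 0) (op_dom T) T).

Definition opnorm V W (T : operator V W) : \bar R :=
  ereal_sup [set (rnorm (T v))%:E | v in [set v | op_dom T v /\ rnorm v <= 1]].

Definition bounded_operator V W (B : operator V W) : Prop :=
  [/\ op_dom B = setT, linear_operator B & (opnorm B < +oo)%E].

End Operators.

Section FieldOperators.
Context (R : realType) (k : scalar_kind) (X : topologicalType).
Implicit Types E F : continuous_field R k X.

Definition fiber_operator E F : Type := {x : X & operator (E x) (F x)}.

Definition base E F (T : fiber_operator E F) : X := projT1 T.

Definition oper E F (T : fiber_operator E F) :
  operator (E (base T)) (F (base T)) := projT2 T.

Definition inv_fiber E F (T : fiber_operator E F) : fiber_operator F E :=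
  existT (fun x => operator (F x) (E x)) (base T) (inv_operator (oper T)).

Definition Cl E F : set (fiber_operator E F) :=
  [set T | closed_operator (oper T)].

Definition Lb E F : set (fiber_operator E F) :=
  [set B | bounded_operator (oper B)].

Definition G_continuous E F (S : forall x, operator (E x) (F x)) : Prop :=
  forall (x : X) (v : E x), op_dom (S x) v ->
    exists f : forall y, E y,
      [/\ sections E f, forall y, op_dom (S y) (f y),
          sections F (fun y => S y (f y)) & f x = v].

Definition strongly_continuous E F (B : forall x, operator (E x) (F x)) : Prop :=
  (forall x, bounded_operator (B x)) /\
  (forall f, sections E f -> sections F (fun x => B x (f x))).

Definition inv_locally_bounded E F (S : forall x, operator (E x) (F x)) : Prop :=
  forall x0 : X, exists2 U, nbhs x0 U &
    (ereal_sup [set opnorm (inv_operator (S x)) | x in U] < +oo)%E.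

End FieldOperators.

Section Nets.
Context (d : Order.disp_t) (A : preorderType d).

Definition directed : Prop :=
  inhabited A /\ forall a b : A, exists c : A, (a <= c)%O /\ (b <= c)%O.

(* Convergence of a net u to l is u @ tails A --> l. *)
Definition tails : set_system A :=
  filter_from setT (fun a0 => [set a | (a0 <= a)%O]).

Context (R : realType) (k : scalar_kind) (X : topologicalType).
Context (E F : continuous_field R k X).

Definition G_cvg (T : A -> fiber_operator E F) (Too : fiber_operator E F) : Prop :=
  (fun a => base (T a)) @ tails --> base Too /\
  forall v, op_dom (oper Too) v ->
    exists w : forall a, E (base (T a)),
      [/\ forall a, op_dom (oper (T a)) (w a),
          (fun a => point_of (w a)) @ tails --> point_of v &
          (fun a => point_of (oper (T a) (w a))) @ tails -->
            point_of (oper Too v)].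

Definition ms_cvg (B : A -> fiber_operator E F) (Boo : fiber_operator E F) : Prop :=
  (fun a => base (B a)) @ tails --> base Boo /\
  forall (w : forall a, E (base (B a))) (v : E (base Boo)),
    (fun a => point_of (w a)) @ tails --> point_of v ->
    (fun a => point_of (oper (B a) (w a))) @ tails --> point_of (oper Boo v).

End Nets.

(* Main.v *)
(* Inverting an operator only swaps the two coordinates of its graph, so closed
   graphs, G-continuity and G-convergence are symmetric under inversion. For
   bijective operators the closed graph theorem makes the inverses bounded. A
   local bound M on them gives, for u in the domain of T,
   ||T^-1 w - u|| <= M ||w - T u||: an approximation u provided by G-continuity
   or G-convergence, for which T u is close to w, is thus close to T^-1 w.
   Conversely, any vector w = T v extends to a continuous section f of the field,
   and applying the inverses to f yields the approximations of v. *)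
Require Import Defs.
From mathcomp Require Import all_boot all_order all_algebra.
From mathcomp Require Import all_classical all_reals all_analysis.
From mathcomp Require Import complex lra.
Set Implicit Arguments.
Unset Strict Implicit.
Unset Printing Implicit Defensive.
Import Order.TTheory GRing.Theory Num.Theory.
Import numFieldNormedType.Exports.
Local Open Scope classical_set_scope.
Local Open Scope ring_scope.

(** * Real-valued norms over real and complex scalars *)

Section RealScalars.
Context (R : realType) (k : scalar_kind).

Definition of_real (r : R) : scalar_field R k :=
  match k return scalar_field R k with
  | RealScalars => r
  | ComplexScalars => (r%:C)%C
  end.

Lemma of_realK r : real_part (of_real r) = r.
Proof. by rewrite /of_real; case: k. Qed.

Lemma of_real_gt0 r : 0 < r -> 0 < of_real r.
Proof. by rewrite /of_real; case: k => //=; rewrite ltcR. Qed.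

Lemma of_realM r s : of_real (r * s) = of_real r * of_real s.
Proof. by rewrite /of_real; case: k => //=; rewrite rmorphM. Qed.

Lemma of_real1 : of_real 1 = 1.
Proof. by rewrite /of_real; case: k. Qed.

Lemma real_partM_of_real r (z : scalar_field R k) :
  real_part (`|of_real r| * z) = `|r| * real_part z.
Proof.
rewrite /of_real; case: k z => //= -[a b].
by rewrite normc_def /= expr0n /= addr0 sqrtr_sqr mul0r subr0.
Qed.

(** Nonnegative complex numbers have zero imaginary part, so their order is that of the real parts;
    this lets real radii replace radii in the scalar field. *)
Lemma lt_real_part (a b : scalar_field R k) : 0 <= a -> 0 <= b ->
  (a < b) = (real_part a < real_part b).
Proof.
case: k a b => //= -[a a'] [b b']; rewrite !lecE /= => /andP[/eqP -> _].
by case/andP=> /eqP -> _; rewrite ltcE /= eqxx.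
Qed.

Context (V : normedModType (scalar_field R k)).
Implicit Types u v w : V.

Lemma rnorm_ge0 v : 0 <= rnorm v.
Proof. by rewrite -(real_part0 R k); exact: le_real_part. Qed.

Lemma rnorm_eq0 v : rnorm v = 0 -> v = 0.
Proof.
move=> v0; apply/eqP/negPn/negP; rewrite -normr_gt0 lt_real_part//.
by rewrite -/(rnorm v) v0 real_part0 ltxx.
Qed.

Lemma rnormZ r v : rnorm (of_real r *: v) = `|r| * rnorm v.
Proof. by rewrite /rnorm normrZ real_partM_of_real. Qed.

Lemma rnormN v : rnorm (- v) = rnorm v.
Proof. by rewrite /rnorm normrN. Qed.

Lemma rnorm_sym u v : rnorm (u - v) = rnorm (v - u).
Proof. by rewrite -rnormN opprB. Qed.

Lemma rnormD u v : rnorm (u + v) <= rnorm u + rnorm v.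
Proof.
by have := rnorm_tri u 0 (- v); rewrite opprK subr0 add0r.
Qed.

(** A positive radius in the scalar field is real, so [of_real] and [real_part] translate radii in
    both directions. *)
Lemma rnorm_cvgP (T : Type) (F : set_system T) (FF : Filter F) (f : T -> V) v :
  f @ F --> v <-> forall e : R, 0 < e -> \forall t \near F, rnorm (f t - v) < e.
Proof.
split=> [/cvgrPdistC_lt fv e e0|fv].
  have e0' := @of_real_gt0 e e0.
  by have := fv _ e0'; apply: filterS => t; rewrite lt_real_part ?(ltW e0')// of_realK.
apply/cvgrPdistC_lt => e e0; have e0' := ltW e0.
have /fv : 0 < real_part e by rewrite -(real_part0 R k) -lt_real_part.
by apply: filterS => t; rewrite lt_real_part.
Qed.

End RealScalars.

Section Complete.
Context (R : realType) (k : scalar_kind).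
Context (V : completeNormedModType (scalar_field R k)).

Lemma rnorm_cauchy_cvg (u : nat -> V) :
  (forall e : R, 0 < e -> exists N, forall n, (N <= n)%N -> rnorm (u n - u N) < e) ->
  exists l : V, u @ \oo --> l.
Proof.
move=> uC; suff : cvg (u @ \oo) by move=> cu; exists (lim (u @ \oo)).
apply: cauchy_cvg; apply: cauchy_exP => e e0.
have /uC[N uN] : 0 < real_part e.
  by rewrite -(real_part0 R k) -lt_real_part// ltW.
exists (u N), N => // n /= Nn; rewrite -ball_normE /= lt_real_part ?(ltW e0)//.
by rewrite -/(rnorm _) rnorm_sym uN.
Qed.

End Complete.

(** * Convergence in the total space of a field *)

Section TotalSpaceCvg.
Context (R : realType) (k : scalar_kind) (X : topologicalType).
Context (E : continuous_field R k X) (I : Type) (F : set_system I).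
Context {FF : Filter F}.

Lemma tube_nbhs (V : set X) (f : forall x, E x) (e : R) (p : total_space E) :
  open V -> sections E f -> 0 < e -> tube V f e p -> nbhs p (tube V f e).
Proof.
move=> oV Cf e0 Vp; apply: open_nbhs_nbhs; split=> //.
exists [set tube V f e]; last by rewrite bigcup_set1.
by move=> _ ->; exists V, f, e.
Qed.

Lemma nbhs_tube (U : set (total_space E)) p : nbhs p U ->
  exists (V : set X) f e, [/\ open V, sections E f, 0 < e, tube V f e p &
    tube V f e `<=` U].
Proof.
rewrite nbhsE => -[B [[D sD <-] [W DW Wp]] sU].
have [V [f [e [oV Cf e0 WE]]]] := sD _ DW.
exists V, f, e; rewrite -WE; split=> //.
by apply: subset_trans sU => q Wq; exists W.
Qed.

(** One section [f] through [v] suffices to test convergence: given another tube around a section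
    [g] that contains [v], continuity of the norm of [f - g] at [x] puts a thin tube around [f],
    over a small neighborhood of [x], inside it. *)
Lemma cvg_point_ofP (q : I -> total_space E) x (v : E x) f :
  sections E f -> f x = v ->
  q @ F --> point_of v <->
    (fun i => projT1 (q i)) @ F --> x /\
    forall e : R, 0 < e ->
      \forall i \near F, rnorm (projT2 (q i) - f (projT1 (q i))) < e.
Proof.
move=> Cf fx; split=> [qv|[qx qf]].
  split=> [W|e e0].
    rewrite nbhsE => -[V [oV Vx] sVW].
    (* The radius 1 is arbitrary: this tube only serves to confine the base points to [V]. *)
    have vV : nbhs (point_of v) (tube V f 1).
      by apply: tube_nbhs => //; split=> //=; rewrite fx subrr rnorm0.
    by apply: (@filterS _ F _ _ _ _ (qv _ vV)) => i [Vi _]; exact: sVW.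
  have ve : nbhs (point_of v) (tube setT f e).
    apply: tube_nbhs => //; first exact: openT.
    by split=> //=; rewrite fx subrr rnorm0.
  by apply: (@filterS _ F _ _ _ _ (qv _ ve)) => i [].
move=> U /nbhs_tube[V [g [e [oV Cg e0 [/= Vx vg] sU]]]].
(* Half of the slack of [v] in the tube around [g] is spent on the distance from [q i] to [f], the
   other half on the variation of the norm of [f - g]. *)
have d0 : 0 < (e - rnorm (v - g x)) / 2 by rewrite divr_gt0// subr_gt0.
have cfg := sections_norm (sections_sub Cf Cg).
have fg : \forall y \near x,
    rnorm (f y - g y) < rnorm (v - g x) + (e - rnorm (v - g x)) / 2.
  have /cvgrPdist_lt/(_ _ d0) := cfg x; apply: filterS => y /=.
  by rewrite fx ltr_distlC => /andP[].
have qV : \forall i \near F, V (projT1 (q i)).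
  exact: (qx V (open_nbhs_nbhs (conj oV Vx))).
apply: (@filterS3 _ F _ _ _ _ _ _ qV (qf _ d0) (qx _ fg)) => i Vi qfi fgi; apply: sU; split=> //.
apply: (le_lt_trans (rnorm_tri _ (f (projT1 (q i))) _)).
by apply: (lt_le_trans (ltrD qfi fgi)); rewrite addrCA -splitr subrKC.
Qed.

Lemma cvg_section (b : I -> X) x f : sections E f -> b @ F --> x ->
  (fun i => point_of (f (b i))) @ F --> point_of (f x).
Proof.
move=> Cf bx; apply/(cvg_point_ofP _ Cf erefl); split=> // e e0.
by apply: nearW => i /=; rewrite subrr rnorm0.
Qed.

(** The net and its limit lie in different fibers in general; a section through [w] provides a
    reference vector in every fiber for the triangle inequality. *)
Lemma cvg_point_of_dist (b : I -> X) (u v : forall i, E (b i)) x (w : E x) :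
  (fun i => point_of (u i)) @ F --> point_of w ->
  (forall e : R, 0 < e -> \forall i \near F, rnorm (v i - u i) < e) ->
  (fun i => point_of (v i)) @ F --> point_of w.
Proof.
have [f Cf fx] := sections_full w.
move=> /(cvg_point_ofP _ Cf fx)[bx uf] vu; apply/(cvg_point_ofP _ Cf fx).
split=> // e e0; have e20 : 0 < e / 2 by rewrite divr_gt0.
have := vu _ e20; have := uf _ e20; apply: filterS2 => i /= ufi vui.
by rewrite (le_lt_trans (rnorm_tri _ (u i) _))// (splitr e) ltrD.
Qed.

Lemma dist_cvg_point_of (b : I -> X) (u v : forall i, E (b i)) x (w : E x) :
  (fun i => point_of (u i)) @ F --> point_of w ->
  (fun i => point_of (v i)) @ F --> point_of w ->
  forall e : R, 0 < e -> \forall i \near F, rnorm (v i - u i) < e.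
Proof.
have [f Cf fx] := sections_full w.
move=> /(cvg_point_ofP _ Cf fx)[_ uf] /(cvg_point_ofP _ Cf fx)[_ vf] e e0.
have e20 : 0 < e / 2 by rewrite divr_gt0.
have := vf _ e20; have := uf _ e20; apply: filterS2 => i /= ufi vfi.
rewrite (le_lt_trans (rnorm_tri _ (f (b i)) _))// (splitr e) ltrD//.
by rewrite rnorm_sym.
Qed.

End TotalSpaceCvg.

(** * Closed operators, operator norms and inverses *)

Section Operators.
Context (R : realType) (k : scalar_kind).
Context (V W : completeNormedModType (scalar_field R k)).
Implicit Types T : operator V W.

Lemma linear_operatorB T u v : linear_operator T -> op_dom T u -> op_dom T v ->
  op_dom T (u - v) /\ T (u - v) = T u - T v.
Proof.
move=> [_ Tdom Tlin] Tu Tv; rewrite -scaleN1r addrC; split; first exact: Tdom.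
by rewrite Tlin// scaleN1r addrC.
Qed.

Lemma linear_operator0 T : linear_operator T -> T 0 = 0.
Proof.
by move=> Tlin; have [T0 _ _] := Tlin; have [_] := linear_operatorB Tlin T0 T0; rewrite !subrr.
Qed.

Lemma linear_operatorZ T a u : linear_operator T -> op_dom T u ->
  op_dom T (a *: u) /\ T (a *: u) = a *: T u.
Proof.
move=> Tlin Tu; have [T0 Td Tl] := Tlin; split.
  by have := Td a _ _ Tu T0; rewrite addr0.
by have := Tl a _ _ Tu T0; rewrite addr0 linear_operator0// addr0.
Qed.

Lemma closed_operator_cvg T (u : nat -> V) v w : closed_operator T ->
  (forall n, op_dom T (u n)) -> u @ \oo --> v -> (T \o u) @ \oo --> w ->
  op_dom T v /\ w = T v.
Proof.
move=> [_ Tcl] Tu uv Tuw.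
apply: (@closed_cvg _ _ \oo _ (fun n => (u n, T (u n))) _ Tcl _ (v, w)).
  by apply: nearW => n; split; first exact: Tu.
exact: cvg_pair.
Qed.

(** A nonzero [v] scaled to norm 1 stays in the domain and competes in the supremum defining
    [opnorm]. *)
Lemma opnorm_le T (M : R) v : linear_operator T -> op_dom T v ->
  (opnorm T <= M%:E)%E -> rnorm (T v) <= M * rnorm v.
Proof.
move=> Tlin Tv TM; have [v0|v0] := eqVneq (rnorm v) 0.
  by rewrite (rnorm_eq0 v0) linear_operator0// !rnorm0 mulr0.
have vgt0 : 0 < rnorm v by rewrite lt_neqAle eq_sym v0 rnorm_ge0.
have [Tdv TZ] := linear_operatorZ (of_real k (rnorm v)^-1) Tlin Tv.
have : ((rnorm (T (of_real k (rnorm v)^-1 *: v)))%:E <= opnorm T)%E.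
  apply: ereal_sup_ubound; exists (of_real k (rnorm v)^-1 *: v) => //; split=> //.
  by rewrite rnormZ ger0_norm ?invr_ge0 ?rnorm_ge0// mulVf.
move=> /le_trans/(_ TM); rewrite lee_fin TZ rnormZ.
by rewrite ger0_norm ?invr_ge0 ?rnorm_ge0// ler_pdivrMl// mulrC.
Qed.

Lemma opnorm_lty T (M : R) : (forall v, op_dom T v -> rnorm v <= 1 -> rnorm (T v) <= M) ->
  (opnorm T < +oo)%E.
Proof.
move=> TM; apply: (@le_lt_trans _ _ M%:E); last by rewrite ltry.
by apply: ge_ereal_sup => _ [v [Tv v1] <-]; rewrite lee_fin TM.
Qed.

End Operators.

Section InverseOperators.
Context (R : realType) (k : scalar_kind).
Context (V W : completeNormedModType (scalar_field R k)).
Implicit Types T : operator V W.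

Lemma inv_operatorK T v :
  injective_operator T -> op_dom T v -> inv_operator T (T v) = v.
Proof. by move=> Tinj Tv; exact: (pinvKV _ Tinj (mem_set Tv)). Qed.

Lemma inv_operatorP T w : injective_operator T -> op_dom (inv_operator T) w ->
  op_dom T (inv_operator T w) /\ T (inv_operator T w) = w.
Proof. by move=> Tinj [v Tv <-]; rewrite inv_operatorK. Qed.

Lemma bijective_operator_inj T : bijective_operator T -> injective_operator T.
Proof. by case. Qed.

Lemma inv_operator_dom T : bijective_operator T -> op_dom (inv_operator T) = setT.
Proof. by move=> /set_bij_surj Tsurj; apply/seteqP; split. Qed.

Lemma inv_operator_closed T : closed_operator T -> injective_operator T ->
  closed_operator (inv_operator T).
Proof.
move=> [Tlin Tcl] Tinj; have [T0 Tdom Tl] := Tlin; split.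
  split.
  - by exists 0 => //; exact: linear_operator0.
  - move=> a _ _ [u Tu <-] [v Tv <-].
    by exists (a *: u + v); [exact: Tdom|exact: Tl].
  - move=> a _ _ [u Tu <-] [v Tv <-]; rewrite !inv_operatorK// -Tl//.
    by rewrite inv_operatorK//; exact: Tdom.
rewrite (_ : op_graph _ = unstable.swap @^-1` op_graph T).
  exact: (continuous_closedP _).1 (@swap_continuous W V) _ Tcl.
apply/seteqP; split=> -[w v] /=; rewrite /op_graph /=.
  by move=> [Tw ->]; have [] := inv_operatorP Tinj Tw.
by move=> [Tv ->]; split; [exists v|exact/esym/inv_operatorK].
Qed.

(** Since [u] is the image of [T u] under the inverse, linearity makes the difference on the left
    the image of [w - T u]. *)
Lemma inv_operator_dist T (M : R) u w : closed_operator T -> bijective_operator T ->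
  (opnorm (inv_operator T) <= M%:E)%E -> op_dom T u ->
  rnorm (inv_operator T w - u) <= M * rnorm (w - T u).
Proof.
move=> Tcl Tbij TM Tu; have Tinj := bijective_operator_inj Tbij.
have Tlin := (inv_operator_closed Tcl Tinj).1; have Tdom := inv_operator_dom Tbij.
have D v : op_dom (inv_operator T) v by rewrite Tdom.
rewrite -{1}(inv_operatorK Tinj Tu).
have [Dwu <-] := linear_operatorB Tlin (D w) (D (T u)).
exact: opnorm_le.
Qed.

End InverseOperators.

(** * Baire category and the closed graph theorem *)

Lemma half_expn_lt (R : realType) (e : R) : 0 < e -> exists N, 2^-1 ^+ N < e.
Proof.
move=> e0; have : \forall n \near \oo, (2^-1 : R) ^+ n < e.
  apply: (cvgr_lt (0 : R)) => //; apply: cvg_expr.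
  by rewrite ger0_norm// invf_lt1// ltr1n.
by case=> N _ NP; exists N; exact: (NP N (leqnn N)).
Qed.

Section ClosedGraph.
Context (R : realType) (k : scalar_kind).
Implicit Types V W : completeNormedModType (scalar_field R k).

Lemma rnorm_lim_le V (u : nat -> V) l v (r : R) : u @ \oo --> l ->
  (\forall n \near \oo, rnorm (u n - v) <= r) -> rnorm (l - v) <= r.
Proof.
move=> /rnorm_cvgP ul uv; apply/ler_addgt0Pr => e e0.
near \oo => n; rewrite [leRHS]addrC.
apply: (le_trans (rnorm_tri _ (u n) _)); rewrite lerD//.
  by rewrite rnorm_sym ltW//; near: n; exact: ul.
by near: n.
Unshelve. all: by end_near. Qed.

(* A form of Baire's theorem. The library proves it only over a realType, hence
   the nested balls here, which also serve complex scalars. *)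
Lemma dense_in_ball_of_cover V (C : nat -> set V) :
  (forall v, exists n, C n v) ->
  exists n v (r : R), 0 < r /\ forall u (s : R), rnorm (u - v) < r -> 0 < s ->
    exists2 c, C n c & rnorm (c - u) < s.
Proof.
move=> Ccover; apply: contrapT => nowhere.
(* From an index and a ball (center, radius), a closed ball of at most half the radius is found
   inside the given one and disjoint from [C] at that index. *)
have step (a : nat * (V * R)) : exists b : V * R, 0 < a.2.2 ->
    [/\ 0 < b.2, rnorm (b.1 - a.2.1) + b.2 <= a.2.2, b.2 <= a.2.2 / 2 &
     forall c, C a.1 c -> b.2 < rnorm (c - b.1)].
  case: a => n [v r] /=; have [r0|r0] := ltP 0 r; last by exists (v, r).
  (* Otherwise [C n] would be dense in the ball of radius [r / 2] around [v]: a point [u] of it at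
     distance at least [s] from [C n] is the center of a suitable ball, and halving [s] makes the
     avoidance strict. *)
  apply: contrapT => H; apply: nowhere; exists n, v, (r / 2).
  split=> [|u s uv s0]; first by rewrite divr_gt0.
  apply: contrapT => far; apply: H; exists (u, Num.min (s / 2) (r / 2)) => _ /=.
  split.
  - by rewrite lt_min !divr_gt0.
  - rewrite [leRHS]splitr lerD ?(ltW uv)// ge_min lexx orbT//.
  - by rewrite ge_min lexx orbT.
  - move=> c Cc; rewrite ltNge; apply/negP => cu; apply: far; exists c => //.
    rewrite (le_lt_trans cu)// gt_min; apply/orP; left; lra.
have [f fP] := choice step.
(* The indices are shifted by one: ball [n.+1] is the one that avoids [C n]. *)
pose fix x n := if n is m.+1 then f (m, x m) else (0, 1).
have x0 n : 0 < (x n).2 by elim: n => //= n /(fP (n, x n))[].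
have x_dist n j : rnorm ((x (n + j)%N).1 - (x n).1) + (x (n + j)%N).2 <= (x n).2.
  elim: j => [|j IH]; first by rewrite addn0 subrr rnorm0 add0r.
  have [_ + _ _] := fP ((n + j)%N, x (n + j)%N) (x0 _).
  rewrite addnS /= => fj.
  have := rnorm_tri (x (n + j).+1).1 (x (n + j)%N).1 (x n).1; rewrite /=; lra.
have x_small n : (x n).2 <= 2^-1 ^+ n.
  elim: n => [|n IH]; first by rewrite expr0.
  have [_ _ fn _] := fP (n, x n) (x0 _).
  by rewrite (le_trans fn)//= exprSr ler_pM2r.
have x_le n m : (n <= m)%N -> rnorm ((x m).1 - (x n).1) <= (x n).2.
  by move=> nm; have := x_dist n (m - n)%N; rewrite subnKC//; have := x0 m; lra.
have [e e0|l xl] := rnorm_cauchy_cvg (u := fun n => (x n).1).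
  have [N Ne] := half_expn_lt e0; exists N => n Nn.
  by rewrite (le_lt_trans (x_le _ _ Nn))// (le_lt_trans (x_small _)).
(* The limit of the centers lies in every closed ball, hence in ball [n.+1], which avoids the very
   set [C n] containing it. *)
have [n Cl] := Ccover l.
have [_ _ _ /(_ l Cl)] := fP (n, x n) (x0 _); rewrite ltNge => /negP; apply.
apply: (rnorm_lim_le xl); exists n.+1 => // m /= nm.
exact: (x_le n.+1).
Qed.

(* The preimages of balls cover V, so one of them is dense in a ball; a
   geometric series of approximations then reaches every point of a ball around
   0, and closedness of the graph identifies the image of its sum. *)
Lemma closed_graph V W (T : operator V W) :
  closed_operator T -> op_dom T = setT -> (opnorm T < +oo)%E.
Proof.
move=> Tcl domT; have Tlin := Tcl.1; have [_ _ Tl] := Tlin.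
have D v : op_dom T v by rewrite domT.
have TB u v : T (u - v) = T u - T v by have [] := linear_operatorB Tlin (D u) (D v).
have TD u v : T (u + v) = T u + T v by have := Tl 1 u v (D u) (D v); rewrite !scale1r.
have TZ a v : T (a *: v) = a *: T v by have [] := linear_operatorZ a Tlin (D v).
have [v|n [v0 [r [r0 dense]]]] :=
    dense_in_ball_of_cover (C := fun n => [set v | rnorm (T v) <= n%:R]).
  exists (Num.truncn (rnorm (T v))).+1 => /=.
  by rewrite ltW// truncnS_gt.
pose q : R := 2^-1; have q0 j : 0 < q ^+ j by rewrite exprn_gt0// invr_gt0.
pose M : R := n%:R + n%:R.
have M0 : 0 <= M by rewrite addr_ge0.
(* Subtracting approximations of [h + v0] and of [v0] moves the ball of density to the origin; the
   two images add up, whence [M] is twice [n]. *)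
have approx0 (h : V) (s : R) : rnorm h < r -> 0 < s ->
    exists2 c, rnorm (T c) <= M & rnorm (h - c) < s.
  move=> hr s0; have s20 : 0 < s / 2 by rewrite divr_gt0.
  have [||c1 Tc1 hc1] := dense (h + v0) (s / 2) => //; first by rewrite addrK.
  have [||c2 Tc2 hc2] := dense v0 (s / 2) => //; first by rewrite subrr rnorm0.
  exists (c1 - c2).
    by rewrite TB (le_trans (rnormD _ _))// rnormN lerD.
  rewrite rnorm_sym (_ : _ - h = (c1 - (h + v0)) - (c2 - v0)).
    by rewrite (le_lt_trans (rnormD _ _))// rnormN (splitr s) ltrD.
  by rewrite opprB addrA opprD [c1 + (_ - _)]addrA subrK addrAC.
(* Rescaling by [q ^+ j] yields one step of the series: the remainder shrinks by the factor [q], and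
   the image of the correction shrinks along with it. *)
have approx (a : nat * V) : exists c, rnorm a.2 < r * q ^+ a.1 ->
    rnorm (T c) <= M * q ^+ a.1 /\ rnorm (a.2 - c) < r * q ^+ a.1.+1.
  case: a => j h /=; have [hr|hr] := ltP (rnorm h) (r * q ^+ j); last first.
    by exists 0.
  have qj := q0 j.
  have [||c Tc hc] := approx0 (of_real k (q ^+ j)^-1 *: h) (r * q).
  - by rewrite rnormZ gtr0_norm ?invr_gt0// ltr_pdivrMl// mulrC.
  - by rewrite mulr_gt0// invr_gt0.
  exists (of_real k (q ^+ j) *: c) => _; split.
    by rewrite TZ rnormZ gtr0_norm// mulrC ler_pM2r.
  rewrite (_ : h - _ = of_real k (q ^+ j) *: (of_real k (q ^+ j)^-1 *: h - c)).
    by rewrite rnormZ gtr0_norm// exprS mulrA mulrC ltr_pM2r.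
  by rewrite scalerBr scalerA -of_realM mulfV ?gt_eqF// of_real1 scale1r.
have [g gP] := choice approx.
have bound (h : V) : rnorm h < r -> rnorm (T h) <= M * 2.
  (* [w j] is a partial sum of corrections, each chosen for the current remainder [h - w j]. *)
  move=> hr; pose fix w j := if j is i.+1 then w i + g (i, h - w i) else 0.
  have wh j : rnorm (h - w j) < r * q ^+ j.
    elim: j => [|j /(gP (j, _))[_ /=]]; first by rewrite subr0 mulr1.
    by rewrite opprD addrA.
  have Tw j : rnorm (T (w j.+1) - T (w j)) <= M * q ^+ j.
    by rewrite /= TD addrAC subrr add0r; have [] := gP (j, _) (wh j).
  have Tw_dist N j : rnorm (T (w (N + j)%N) - T (w N)) <= M * 2 * q ^+ N.
    (* The induction needs the exact finite geometric sum; dropping its negative term afterwards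
       gives the tail bound. *)
    suff : rnorm (T (w (N + j)%N) - T (w N)) <= M * 2 * (q ^+ N - q ^+ (N + j)).
      move=> /le_trans; apply; rewrite ler_wpM2l ?mulr_ge0//.
      by have := q0 (N + j)%N; lra.
    elim: j => [|j IH]; first by rewrite addn0 !subrr rnorm0 mulr0.
    rewrite addnS; apply: (le_trans (rnorm_tri _ (T (w (N + j)%N)) _)).
    apply: (le_trans (lerD (Tw _) IH)).
    rewrite exprS /q; lra.
  have [e e0|y Twy] := rnorm_cauchy_cvg (u := T \o w).
    (* The added 1 keeps the denominator positive when [M] is 0. *)
    have Me : 0 < e / (M * 2 + 1) by rewrite divr_gt0// ltr_wpDl// mulr_ge0.
    have [N Ne] := half_expn_lt Me; exists N => i Ni.
    have := Tw_dist N (i - N)%N; rewrite subnKC// => /le_lt_trans; apply.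
    move: Ne; rewrite ltr_pdivlMr -/q; last by rewrite ltr_wpDl// mulr_ge0.
    by have := q0 N; lra.
  have [_ <-] : op_dom T h /\ y = T h.
    apply: (closed_operator_cvg (u := w) Tcl) => //; apply/rnorm_cvgP => e e0.
    have [N Ne] := half_expn_lt (divr_gt0 e0 r0).
    exists N => // i /= Ni; rewrite rnorm_sym (lt_trans (wh _))//.
    rewrite mulrC -ltr_pdivlMr// (le_lt_trans _ Ne)//.
    by rewrite ler_wiXn2l// ?invr_ge0// invf_le1// ler1n.
  (* At index 0 the tail bound compares with [T (w 0) = 0], so it bounds the limit [y] itself. *)
  rewrite -[y]subr0; apply: (rnorm_lim_le Twy); apply: nearW => j.
  have := Tw_dist 0%N j; rewrite add0n expr0 mulr1 /=.
  by rewrite (linear_operator0 Tlin).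
(* A vector of norm at most 1 enters the ball of radius [r] after scaling by [r / 2]; undoing the
   scaling gives the factor [2 / r]. *)
apply: (@opnorm_lty _ _ _ _ _ (M * 2 * (2 / r))) => v _ v1.
have /bound : rnorm (of_real k (r / 2) *: v) < r.
  rewrite rnormZ gtr0_norm ?divr_gt0// (@le_lt_trans _ _ (r / 2))//.
    by rewrite ler_piMr// ltW// divr_gt0.
  lra.
rewrite TZ rnormZ gtr0_norm ?divr_gt0// -ler_pdivlMl ?divr_gt0//.
by rewrite invf_div mulrC.
Qed.

Lemma inv_operator_bounded V W (T : operator V W) :
  closed_operator T -> bijective_operator T -> bounded_operator (inv_operator T).
Proof.
move=> Tcl Tbij; have Tdom := inv_operator_dom Tbij.
have Tcl' := inv_operator_closed Tcl (bijective_operator_inj Tbij).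
by split; [|exact: Tcl'.1|exact: closed_graph].
Qed.

End ClosedGraph.

(** * Inverses of sections of operators *)

Lemma ereal_sup_lty_bound (R : realType) (D : set (\bar R)) :
  (ereal_sup D < +oo)%E ->
  exists2 M : R, 0 < M & forall x, D x -> (x <= M%:E)%E.
Proof.
(* The maximum with 1 makes the bound positive, so that one can divide by it, and also covers a
   supremum equal to [-oo]. *)
move=> Dlty; exists (Num.max 1 (fine (ereal_sup D))); first by rewrite lt_max ltr01.
move=> x Dx; apply: (le_trans (ereal_sup_ubound Dx)).
case: (ereal_sup D) Dlty => //= [r _|_]; last exact: leNye.
by rewrite lee_fin le_max lexx orbT.
Qed.

Section InverseFields.
Context (R : realType) (k : scalar_kind) (X : topologicalType).
Context (E F : continuous_field R k X).

(** The sections [f] and [S f] that witness G-continuity on one side witness it on the other with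
    their roles exchanged. *)
Lemma G_continuous_inv (S : forall x, operator (E x) (F x)) :
  (forall x, injective_operator (S x)) ->
  G_continuous S <-> G_continuous (fun x => inv_operator (S x)).
Proof.
move=> Sinj; split=> SG x.
  move=> _ [v Sv <-]; have [f [Cf Sf CSf fx]] := SG x v Sv.
  exists (fun y => S y (f y)); split=> //; last by rewrite fx.
    by move=> y; exists (f y).
  rewrite (_ : (fun y => _) = f)//; apply: functional_extensionality_dep => y.
  exact: inv_operatorK.
move=> v Sv; have [|f [Cf Sf CSf fx]] := SG x (S x v); first by exists v.
exists (fun y => inv_operator (S y) (f y)); split=> //.
- by move=> y; have [] := inv_operatorP (Sinj y) (Sf y).
- rewrite (_ : (fun y => _) = f)//; apply: functional_extensionality_dep => y.
  by have [] := inv_operatorP (Sinj y) (Sf y).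
- by rewrite fx; exact: inv_operatorK.
Qed.

Lemma G_continuous_inv_strong (S : forall x, operator (E x) (F x)) :
  (forall x, closed_operator (S x)) -> (forall x, bijective_operator (S x)) ->
  inv_locally_bounded S ->
  G_continuous S <-> strongly_continuous (fun x => inv_operator (S x)).
Proof.
move=> Scl Sbij Sbnd; have Sinj x := bijective_operator_inj (Sbij x).
have Sdom x := inv_operator_dom (Sbij x).
have SK x w : S x (inv_operator (S x) w) = w.
  by have [] := inv_operatorP (w := w) (Sinj x); first by rewrite Sdom.
split=> [SG|[_ SC] x v Sv]; last first.
  have [f Cf fx] := sections_full (S x v).
  exists (fun y => inv_operator (S y) (f y)); split; first exact: SC.
  - by move=> y; have [] := inv_operatorP (w := f y) (Sinj y); first by rewrite Sdom.
  - rewrite (_ : (fun y => _) = f)//; apply: functional_extensionality_dep => y.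
    exact: SK.
  - by rewrite fx; exact: inv_operatorK.
split=> [x|f Cf]; first exact: inv_operator_bounded.
apply: sections_local => x e e0.
(* By the choice of [g x], the continuous section [f - S g] vanishes at [x]; near [x] its norm is
   below [e / M], which the bound [M] on the inverses turns into [e]. *)
have [|g [Cg Sg CSg gx]] := SG x (inv_operator (S x) (f x)).
  by have [] := inv_operatorP (w := f x) (Sinj x); first by rewrite Sdom.
have [U xU /ereal_sup_lty_bound[M M0 UM]] := Sbnd x.
have eM : 0 < e / M by rewrite divr_gt0.
have cfg := sections_norm (sections_sub Cf CSg).
have /cvgrPdist_lt/(_ _ eM) fg := cfg x; exists g => //.
apply: filterS2 xU fg => y Uy; rewrite gx SK subrr rnorm0 sub0r normrN.
rewrite ger0_norm ?rnorm_ge0// ltr_pdivlMr// mulrC => /ltW; apply: le_trans.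
by apply: inv_operator_dist => //; apply: UM; exists y.
Qed.

End InverseFields.

(** * Inverses of nets of operators *)

Section InverseNets.
Context (d : Order.disp_t) (A : preorderType d) (A_directed : directed A).

Lemma tails_filter : Filter (@tails d A).
Proof.
have [[a0] Adir] := A_directed.
apply: filter_from_filter; first by exists a0.
move=> a b _ _; have [c [ac bc]] := Adir a b.
by exists c => // z /= cz; split; exact: le_trans cz.
Qed.

Context (R : realType) (k : scalar_kind) (X : topologicalType).
Context (E F : continuous_field R k X).
Implicit Types (T : A -> fiber_operator E F) (Too : fiber_operator E F).

(** The approximating net and its image under the operators exchange roles. *)
Lemma G_cvg_inv T Too :
  (forall a, injective_operator (oper (T a))) -> injective_operator (oper Too) ->
  G_cvg T Too <-> G_cvg (fun a => inv_fiber (T a)) (inv_fiber Too).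
Proof.
move=> Tinj Tooinj; split=> -[bT TG]; split=> // v.
  move=> [u Tu <-]; have [w [Tw wu Twu]] := TG u Tu.
  exists (fun a => oper (T a) (w a)); split=> //.
    by move=> a; exists (w a).
  have -> : oper (inv_fiber Too) (oper Too u) = u by exact: inv_operatorK.
  rewrite (_ : (fun a => _) = fun a => point_of (w a))//.
  by apply/funext => a; congr point_of; exact: (inv_operatorK (Tinj a) (Tw a)).
move=> Tv; have [|w [Tw wu Twu]] := TG (oper Too v); first by exists v.
have TK a := inv_operatorP (Tinj a) (Tw a).
exists (fun a => inv_operator (oper (T a)) (w a)); split.
- by move=> a; exact: (TK a).1.
- have <- : oper (inv_fiber Too) (oper Too v) = v by exact: inv_operatorK.
  exact: Twu.
- rewrite (_ : (fun a => _) = fun a => point_of (w a))//.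
  by apply/funext => a /=; rewrite (TK a).2.
Qed.

Lemma ms_cvg_inv_G_cvg T Too :
  (forall a, bijective_operator (oper (T a))) -> bijective_operator (oper Too) ->
  ms_cvg (fun a => inv_fiber (T a)) (inv_fiber Too) -> G_cvg T Too.
Proof.
move=> Tbij Toobij [bT Tms]; have TF := tails_filter; split=> // v Tv.
have [f Cf fx] := sections_full (oper Too v).
(* The values of [f] at the base points converge to [oper Too v], so meta strong convergence applies
   to them; their preimages are the net required for [v]. *)
have fT := @cvg_section _ _ _ F _ _ TF _ _ _ Cf bT; rewrite fx in fT.
have TK a : op_dom (inv_operator (oper (T a))) (f (base (T a))).
  by rewrite inv_operator_dom.
have {}TK a := inv_operatorP (bijective_operator_inj (Tbij a)) (TK a).
exists (fun a => inv_operator (oper (T a)) (f (base (T a)))); split.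
- by move=> a; exact: (TK a).1.
- have <- : oper (inv_fiber Too) (oper Too v) = v.
    exact: inv_operatorK (bijective_operator_inj Toobij) Tv.
  exact: (Tms (fun a => f (base (T a))) (oper Too v) fT).
- rewrite (_ : (fun a => _) = fun a => point_of (f (base (T a))))//.
  by apply/funext => a /=; rewrite (TK a).2.
Qed.

Lemma G_cvg_ms_cvg_inv T Too :
  (forall a, closed_operator (oper (T a))) ->
  (forall a, bijective_operator (oper (T a))) -> bijective_operator (oper Too) ->
  (exists a0 : A, (ereal_sup
     [set opnorm (oper (inv_fiber (T a))) | a in [set a | (a0 <= a)%O]] < +oo)%E) ->
  G_cvg T Too -> ms_cvg (fun a => inv_fiber (T a)) (inv_fiber Too).
Proof.
move=> Tcl Tbij Toobij [a0 Tbnd] [bT TG]; have TF := tails_filter; split=> // w v wv.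
have [M M0 TM] := ereal_sup_lty_bound Tbnd.
have Tinj a := bijective_operator_inj (Tbij a).
have Tooinj := bijective_operator_inj Toobij.
have [|Tv TvK] := inv_operatorP (w := v) Tooinj; first by rewrite inv_operator_dom.
(* The images of [u] and the given net [w] now have the same limit [v], so their fiberwise distance
   tends to 0. *)
have [u [Tu uv Tuv]] := TG _ Tv; rewrite TvK in Tuv.
apply: cvg_point_of_dist uv _ => e e0.
(* The bound [M] is available only from [a0] on, so the estimate is restricted to this tail. *)
have tail0 : tails [set a | (a0 <= a)%O] by exists a0.
have := @dist_cvg_point_of _ _ _ F _ _ TF _ _ _ _ _ Tuv wv _ (divr_gt0 e0 M0).
apply: filterS2 tail0 => a a0a; rewrite ltr_pdivlMr// mulrC; apply: le_lt_trans.
by apply: inv_operator_dist => //; apply: TM; exists a.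
Qed.

End InverseNets.

Theorem proposition5p7 (R : realType) (k : scalar_kind) (X : topologicalType)
  (E F : continuous_field R k X)
  (S : forall x, operator (E x) (F x))
  (S_closed : forall x, closed_operator (S x))
  (d : Order.disp_t) (A : preorderType d) (A_directed : directed A)
  (T : A -> fiber_operator E F) (T_closed : forall a, Cl (T a))
  (Too : fiber_operator E F) (Too_closed : Cl Too) :
  [/\
    (forall x, injective_operator (S x)) ->
      (forall x, closed_operator (inv_operator (S x))) /\
      (G_continuous S <-> G_continuous (fun x => inv_operator (S x))),

    (forall a, injective_operator (oper (T a))) ->
    injective_operator (oper Too) ->
      [/\ forall a, Cl (inv_fiber (T a)), Cl (inv_fiber Too) &
          G_cvg T Too <-> G_cvg (fun a => inv_fiber (T a)) (inv_fiber Too)],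

    (forall x, bijective_operator (S x)) ->
    inv_locally_bounded S ->
      (G_continuous S <-> strongly_continuous (fun x => inv_operator (S x))) &

    (forall a, bijective_operator (oper (T a))) ->
    bijective_operator (oper Too) ->
      [/\ forall a, Lb (inv_fiber (T a)), Lb (inv_fiber Too),
          ms_cvg (fun a => inv_fiber (T a)) (inv_fiber Too) -> G_cvg T Too &
          (exists a0 : A, (ereal_sup
             [set opnorm (oper (inv_fiber (T a))) | a in [set a | (a0 <= a)%O]]
             < +oo)%E) ->
          (G_cvg T Too <-> ms_cvg (fun a => inv_fiber (T a)) (inv_fiber Too))]].
Proof.
split.
- move=> Sinj; split=> [x|]; first exact: inv_operator_closed.
  exact: G_continuous_inv.
- move=> Tinj Tooinj; split=> [a||]; last exact: G_cvg_inv.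
    exact: inv_operator_closed (T_closed a) (Tinj a).
  exact: inv_operator_closed Too_closed Tooinj.
- exact: G_continuous_inv_strong.
- move=> Tbij Toobij; split=> [a|||Tbnd].
  + exact: inv_operator_bounded (T_closed a) (Tbij a).
  + exact: inv_operator_bounded Too_closed Toobij.
  + exact: ms_cvg_inv_G_cvg.
  + split; last exact: ms_cvg_inv_G_cvg.
    exact: G_cvg_ms_cvg_inv.
Qed.
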